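(* Fix a squarefree integer $D>1$ and let $\varepsilon>0$. There is a constant $c=c(D,\varepsilon)>0$, depending only on $D$ and $\varepsilon$, such that the following holds. Let $K$ be a totally real quartic number field with $\sqrt D\in K$ and with discriminant $\Delta$. Then for each $m\in\mathbb{Z}$ with $0<m\le c\,\Delta^{1/4-\varepsilon}$, there is an element of $m\mathcal{O}_K^+$ that is not a sum of squares of elements of $\mathcal{O}_K$.
   Context: $\mathcal{O}_K$ is the ring of integers of $K$, $\mathcal{O}_K^+$ is the set of its totally positive elements (positive under every embedding $K\hookrightarrow\mathbb{R}$), and $m\mathcal{O}_K^+=\{m\alpha:\alpha\in\mathcal{O}_K^+\}$. A sum of squares means a sum of finitely many (arbitrarily many) squares. *)

(* Defs.v *)
From mathcomp Require Import all_boot all_order all_algebra all_field.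
From mathcomp Require Import reals exp complex.

Set Implicit Arguments.
Unset Strict Implicit.
Unset Printing Implicit Defensive.

Import Order.TTheory GRing.Theory Num.Theory.
Local Open Scope ring_scope.

Definition squarefree (D : int) : Prop :=
  forall d : int, (d ^+ 2 %| D)%Z -> `|d|%N = 1%N.

(* A number field is a [fieldExtType rat]: a field of finite degree
   [\dim {:K}] over the rationals. *)
Section NumberField.
Variable K : fieldExtType rat.

Definition ringOfIntegers (x : K) : Prop := integralOver (intr : int -> K) x.

Definition fieldTrace (x : K) : rat :=
  \tr (passmx.mxof (vbasis {:K}) (vbasis {:K}) (amull x)).

Definition integralBasis (w : (\dim {:K}).-tuple K) : Prop :=
  (forall i, ringOfIntegers (tnth w i)) /\
  (forall x, ringOfIntegers x ->
     exists! a : {ffun 'I_(\dim {:K}) -> int},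
       x = \sum_i tnth w i *~ a i).

(* A relation rather than a function, so that the definition does not depend on
   a choice of integral basis; every number field has exactly one discriminant. *)
Definition isDiscriminant (Delta : int) : Prop :=
  exists2 w : (\dim {:K}).-tuple K, integralBasis w &
    Delta%:~R =
      \det (\matrix_(i, j) fieldTrace (tnth w i * tnth w j)) :> rat.

Definition sumOfIntegerSquares (x : K) : Prop :=
  exists2 s : seq K, (forall y, y \in s -> ringOfIntegers y) &
    x = \sum_(y <- s) y ^+ 2.

Variable R : realType.

(* In [R[i]], [z \is Num.real] means that the imaginary part of [z] is zero. *)
Definition totallyReal : Prop :=
  forall (sigma : {rmorphism K -> R[i]}) (x : K), sigma x \is Num.real.

Definition totallyPositiveInteger (x : K) : Prop :=
  ringOfIntegers x /\ forall sigma : {rmorphism K -> R}, 0 < sigma x.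

Definition multTotallyPositive (m : int) (x : K) : Prop :=
  exists2 a : K, totallyPositiveInteger a & x = m%:~R * a.

End NumberField.

(* Main.v *)
(* Let F = Q(s) with s^2 = D.  If an integer y of K outside F has all its
   conjugates bounded by r, then comparing the lattice spanned by 1, s, y, sy
   with the ring of integers gives Delta <= (24 D r^2)^2; hence r is of order at
   least Delta^(1/4).
   Suppose that every element of m O_K^+ is a sum of squares, and take an integer
   N in (r, r + 1].  Then y + N is totally positive, m (y + N) is a sum of squares
   and lies outside F, so that some squared term z is an integer outside F; as its
   conjugates satisfy z^2 <= m (2r + 1), they are bounded by r / 2 as soon as
   r >= 24 m.  So if m is small compared with Delta^(1/4), integers outside F with
   ever smaller conjugates exist, contradicting the lower bound on r. *)
From HB Require Import structures.
Require Import Defs.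
From mathcomp Require Import all_boot all_order all_algebra all_field.
From mathcomp Require Import perm.
From mathcomp Require Import reals exp complex boolp.
From mathcomp Require Import ring lra.

Import Order.TTheory GRing.Theory Num.Theory.
Local Open Scope ring_scope.

(** * Embeddings of a number field and roots of a minimal polynomial *)

Section Embeddings.
Variables (K : fieldExtType rat) (theta : K) (p : {poly rat}).
Hypothesis gen_theta : <<1; theta>>%VS = {:K}%VS.
Hypothesis minPoly_theta : map_poly (GRing.in_alg K) p = minPoly 1 theta.

(** Every element of K is q(theta) for some rational q, and q(z) does not depend on the choice of q,
    because [p] divides each rational polynomial that vanishes at [theta]. *)
Lemma rmorphism_of_root (L : numFieldType) (z : L) :
  root (map_poly ratr p) z -> exists s : {rmorphism K -> L}, s theta = z.
Proof.
move=> pz0.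
have vanish (q : {poly rat}) :
    (map_poly (GRing.in_alg K) q).[theta] = 0 -> (map_poly ratr q).[z] = 0.
  move=> /eqP q0; apply/eqP; rewrite -[_ == 0]/(root _ _).
  have : minPoly 1 theta %| map_poly (GRing.in_alg K) q.
    by apply: minPoly_dvdp => //; apply/polyOver1P; exists q.
  rewrite -minPoly_theta dvdp_map => /dvdpP [u ->].
  by rewrite rmorphM rootM pz0 orbT.
have rep (x : K) : exists q, x = (map_poly (GRing.in_alg K) q).[theta].
  have /Fadjoin_polyP [q /polyOver1P [u ->] ->] : x \in <<1; theta>>%VS.
    by rewrite gen_theta memvf.
  by exists u.
have [f fE] := choice rep.
pose s x : L := (map_poly ratr (f x)).[z].
have sE q : s (map_poly (GRing.in_alg K) q).[theta] = (map_poly ratr q).[z].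
  apply/eqP; rewrite -subr_eq0 /s -hornerN -hornerD -rmorphB; apply/eqP.
  by apply: vanish; rewrite rmorphB hornerD hornerN -fE subrr.
have s_sub : zmod_morphism s.
  by move=> x y; rewrite {1}(fE x) {1}(fE y) -hornerN -hornerD -rmorphB sE
    rmorphB hornerD hornerN.
have s_mul : monoid_morphism s.
  split=> [|x y].
    have {1}-> : 1 = (map_poly (GRing.in_alg K) 1).[theta].
      by rewrite rmorph1 hornerC.
    by rewrite sE rmorph1 hornerC.
  by rewrite {1}(fE x) {1}(fE y) -hornerM -rmorphM sE rmorphM hornerM.
pose sM : {rmorphism K -> L} := HB.pack s
  (GRing.isZmodMorphism.Build _ _ s s_sub)
  (GRing.isMonoidMorphism.Build _ _ s s_mul).
exists sM; rewrite -[sM theta]/(s theta) -[X in s X](hornerX theta).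
by rewrite -(map_polyX (GRing.in_alg K)) sE map_polyX hornerX.
Qed.

Lemma rmorphism_root (L : numFieldType) (s : {rmorphism K -> L}) :
  root (map_poly ratr p) (s theta).
Proof.
have : s (map_poly (GRing.in_alg K) p).[theta] = 0.
  by rewrite minPoly_theta (rootP (root_minPoly 1 theta)) rmorph0.
rewrite -horner_map -map_poly_comp => /rootP.
congr (root _ _); apply: eq_map_poly => a /=.
by rewrite rmorphZ_num rmorph1 mulr1.
Qed.

Lemma rmorphism_eq (L : numFieldType) (s t : {rmorphism K -> L}) :
  s theta = t theta -> s =1 t.
Proof.
move=> st x.
have /Fadjoin_polyP [q /polyOver1P [u ->] ->] : x \in <<1; theta>>%VS.
  by rewrite gen_theta memvf.
rewrite -!horner_map -!map_poly_comp st; congr (horner _ _).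
by apply: eq_map_poly => a; rewrite /= !rmorphZ_num !rmorph1.
Qed.
End Embeddings.

(** The minimal polynomial of a primitive element has as many distinct complex roots as its degree.
    Each root gives a complex embedding, so by total reality it is real and gives an embedding into
    R. The generator is returned because its distinct images are later the nodes of a Vandermonde
    matrix. *)
Lemma real_embeddings (K : fieldExtType rat) (R : realType) :
  totallyReal K R ->
  exists (theta : K) (sigma : 'I_(\dim {:K}) -> {rmorphism K -> R}),
    injective (fun i => sigma i theta) /\
    forall rho : {rmorphism K -> R}, exists i, rho =1 sigma i.
Proof.
move=> Kreal.
have sepK : separable 1 {:K}.
  by apply/separableP => y _; apply: pcharf0_separable => c;
    rewrite (pchar_lalg K) pchar_num.
pose theta := separable_generator 1 {:K}.
have gen : <<1; theta>>%VS = {:K}%VS.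
  by rewrite -(eq_adjoin_separable_generator sepK) ?sub1v.
have [p pE] : exists p, minPoly 1 theta = map_poly (GRing.in_alg K) p.
  by apply/polyOver1P; apply: minPolyOver.
have sepp : separable_poly (map_poly ratr p : {poly R[i]}).
  have := separableP sepK theta (memvf _).
  by rewrite /separable_element pE !separable_map.
have sizep : size p = (\dim {:K}).+1.
  have := size_minPoly 1 theta; rewrite pE size_map_poly => ->.
  by rewrite -gen dim_Fadjoin dimv1 muln1.
have [r rE] := closed_field_poly_normal (map_poly ratr p : {poly R[i]}).
have lead_neq0 : lead_coef (map_poly ratr p : {poly R[i]}) != 0.
  by rewrite lead_coef_eq0 -size_poly_gt0 size_map_poly sizep.
have rootr z : (z \in r) = root (map_poly ratr p) z.
  by rewrite rE rootZ // root_prod_XsubC.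
have uniqr : uniq r.
  by rewrite -separable_prod_XsubC -(eqp_separable (eqp_scale _ lead_neq0)) -rE.
have sizer : size r = \dim {:K}.
  have := congr1 (size \o @polyseq _) rE => /=.
  by rewrite size_map_poly sizep size_scale // size_prod_XsubC => -[].
have real_root (i : 'I_(\dim {:K})) :
    exists s : {rmorphism K -> R}, ((s theta)%:C)%C = r`_i.
  have /(rmorphism_of_root _ _ _ gen (esym pE)) [s st] :
    root (map_poly ratr p) r`_i by rewrite -rootr mem_nth ?sizer.
  have /complex_realP [x xE] := Kreal s theta.
  have px0 : root (map_poly ratr p) x.
    have := rmorphism_root _ _ _ (esym pE) _ s; rewrite xE.
    rewrite -[(x%:C)%C]/(real_complex R x).
    have -> : map_poly ratr p = map_poly (real_complex R) (map_poly ratr p).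
      by rewrite -map_poly_comp; apply: eq_map_poly => a; rewrite /= fmorph_rat.
    by rewrite fmorph_root.
  have [t tx] := rmorphism_of_root _ _ _ gen (esym pE) _ _ px0.
  by exists t; rewrite tx -xE st.
have [sigma sigmaE] := choice real_root.
exists theta, sigma; split=> [i j /= sij|rho].
  apply/val_inj/eqP; rewrite -(nth_uniq 0 _ _ uniqr) ?sizer ?ltn_ord //.
  by rewrite -!sigmaE sij.
(* Seen in [R[i]], any real embedding sends [theta] to one of the listed roots, and this image
   determines it. *)
pose c : {rmorphism K -> R[i]} := real_complex R \o rho.
have : c theta \in r by rewrite rootr (rmorphism_root _ _ _ (esym pE)).
move=> crho; case: (nthP 0 crho) => i; rewrite sizer => ir ri.
exists (Ordinal ir); apply: (rmorphism_eq _ _ gen).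
apply: (fmorph_inj (real_complex R)).
by rewrite -[RHS]/((sigma _ theta)%:C)%C sigmaE.
Qed.

(** * Trace and discriminant in terms of the embeddings *)

Section EmbeddingMatrix.
Variables (K : fieldExtType rat) (R : realType).
Local Notation n := (\dim {:K}).
Variables (sigma : 'I_n -> {rmorphism K -> R}).

Definition embeddingMatrix (x : 'I_n -> K) : 'M[R]_n :=
  \matrix_(i, k) sigma k (x i).

Lemma embeddingMatrix_comb (A : 'M[rat]_n) (x y : 'I_n -> K) :
  (forall i, y i = \sum_j A i j *: x j) ->
  embeddingMatrix y = map_mx ratr A *m embeddingMatrix x.
Proof.
move=> yE; apply/matrixP => i k; rewrite !mxE yE rmorph_sum.
by apply: eq_bigr => j _; rewrite !mxE rmorphZ_num.
Qed.

Variable theta : K.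
Hypothesis sigma_inj : injective (fun i => sigma i theta).

(** The powers of [theta] are rational combinations of [b], and their matrix is Vandermonde with
    distinct nodes; being invertible, it has only invertible factors. *)
Lemma embeddingMatrix_basis (b : 'I_n -> K) :
  (forall x, exists a : 'I_n -> rat, x = \sum_j a j *: b j) ->
  embeddingMatrix b \in unitmx.
Proof.
move=> span_b.
have [f fE] := choice (fun i : 'I_n => span_b (theta ^+ i)).
have powE : embeddingMatrix (fun i => theta ^+ i) =
    Vandermonde n (\row_k sigma k theta).
  by apply/matrixP => i k; rewrite !mxE rmorphXn.
have : \det (embeddingMatrix (fun i => theta ^+ i)) != 0.
  rewrite powE det_Vandermonde; apply/prodf_neq0 => i _.
  apply/prodf_neq0 => j ij; rewrite !mxE subr_eq0.
  by apply: contraTneq ij => /sigma_inj ->; rewrite ltnn.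
rewrite (embeddingMatrix_comb (\matrix_(i, j) f i j) b) => [|i].
  by rewrite det_mulmx mulf_eq0 negb_or unitmxE unitfE => /andP [].
by rewrite fE; apply: eq_bigr => j _; rewrite mxE.
Qed.

(** The embedding matrix E of a basis diagonalises multiplication by x: M E = E diag(sigma_k x), and
    the trace is invariant under conjugation. *)
Lemma fieldTrace_embeddings (x : K) :
  ratr (fieldTrace x) = \sum_k sigma k x.
Proof.
rewrite /fieldTrace; set M := passmx.mxof _ _ _.
have b_basis : basis_of {:K} (vbasis {:K}) := vbasisP _.
pose b (i : 'I_n) := (vbasis {:K})`_i.
have bU : embeddingMatrix b \in unitmx.
  apply: embeddingMatrix_basis => y; exists (fun j => coord (vbasis {:K}) j y).
  exact: coord_basis b_basis (memvf y).
have ME : map_mx ratr M *m embeddingMatrix b =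
    embeddingMatrix b *m diag_mx (\row_k sigma k x).
  rewrite -(embeddingMatrix_comb M b (fun i => x * b i)) => [|i].
    by apply/matrixP => i k; rewrite mxE mul_mx_diag !mxE rmorphM mulrC.
  have := passmx.mul_mxof (vbasis {:K}) (vbasis {:K}) (amull x)
    (delta_mx 0 i).
  rewrite passmx.vecof_delta lfunE /= -rowE => rowM.
  rewrite -(passmx.rVofK b_basis (x * b i)) -rowM /passmx.vecof.
  by apply: eq_bigr => j _; rewrite !mxE.
have -> : ratr (\tr M) = \tr (map_mx ratr M : 'M[R]_n).
  by rewrite /mxtrace rmorph_sum; apply: eq_bigr => i _; rewrite !mxE.
rewrite -[map_mx _ M](mulmxK bU) ME mxtrace_mulC mulmxA mulVmx // mul1mx.
by rewrite mxtrace_diag; apply: eq_bigr => k _; rewrite mxE.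
Qed.

(** By the trace formula, the matrix of traces is E E^T. *)
Lemma discriminant_embeddings (Delta : rat) (w : n.-tuple K) :
  Delta = \det (\matrix_(i, j) fieldTrace (tnth w i * tnth w j)) ->
  ratr Delta = \det (embeddingMatrix (tnth w)) ^+ 2.
Proof.
move->; rewrite expr2 -[X in _ * X]det_tr -det_mulmx -det_map_mx.
congr (\det _); apply/matrixP => i j; rewrite !mxE /= fieldTrace_embeddings.
by apply: eq_bigr => k _; rewrite !mxE rmorphM.
Qed.
End EmbeddingMatrix.

(** The separate index [n] lets the embeddings and the integral basis be indexed by the literal 4
    later on, instead of by [\dim {:K}]. *)
Lemma totallyReal_discriminant (K : fieldExtType rat) (R : realType) (n : nat)
    (Delta : int) :
  \dim {:K} = n -> totallyReal K R -> isDiscriminant K Delta ->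
  exists (sigma : 'I_n -> {rmorphism K -> R}) (w : 'I_n -> K),
  [/\ forall rho : {rmorphism K -> R}, exists i, rho =1 sigma i,
      forall i, ringOfIntegers (w i),
      forall x, ringOfIntegers x -> exists a : 'I_n -> int,
        x = \sum_i w i *~ a i &
      Delta%:~R = \det (\matrix_(i, k) sigma k (w i)) ^+ 2].
Proof.
case: n / => Kreal [w [w_int w_span] DeltaE].
have [theta [sigma [sigma_inj all_sigma]]] := real_embeddings K R Kreal.
exists sigma, (tnth w); split=> // [x /w_span [a [-> _]]|]; first by exists a.
by rewrite -(discriminant_embeddings _ _ _ _ sigma_inj _ _ DeltaE) ratr_int.
Qed.

(** * Lattice determinants and elementary estimates *)

Lemma integer_comb_det (K : fieldExtType rat) (R : realType) (n : nat)
    (sigma : 'I_n -> {rmorphism K -> R}) (w x : 'I_n -> K) :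
  (forall i, exists a : 'I_n -> int, x i = \sum_j w j *~ a j) ->
  (forall v : 'I_n -> rat, \sum_i v i *: x i = 0 -> forall i, v i = 0) ->
  \det (\matrix_(i, k) sigma k (w i)) ^+ 2 <=
    \det (\matrix_(i, k) sigma k (x i)) ^+ 2.
Proof.
move=> x_comb x_free; have [f fE] := choice x_comb.
pose A : 'M[int]_n := \matrix_(i, j) f i j.
have -> : \matrix_(i, k) sigma k (x i) =
    map_mx intr A *m \matrix_(i, k) sigma k (w i).
  apply/matrixP => i k; rewrite !mxE fE rmorph_sum.
  by apply: eq_bigr => j _; rewrite !mxE rmorphMz mulrzl.
(* A rational vector killed by A would be a linear relation between the [x i]. So det A is a nonzero
   integer, and its square, the ratio of the two sides, is at least 1. *)
have detA_neq0 : \det A != 0.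
  rewrite -(intr_eq0 rat) -det_map_mx; apply/det0P => -[v v_neq0 vA].
  case/negP: v_neq0; apply/eqP/rowP => i; rewrite mxE.
  apply: (x_free (v 0)).
  under eq_bigr => i' _ do rewrite fE scaler_sumr.
  rewrite exchange_big big1 //= => j _.
  have /rowP /(_ j) := vA; rewrite !mxE => vAj.
  rewrite -[RHS](scale0r (w j)) -vAj scaler_suml; apply: eq_bigr => i' _.
  by rewrite !mxE -scaler_int scalerA.
rewrite det_mulmx exprMn det_map_mx.
by rewrite ler_peMl ?sqr_ge0 // -rmorphXn ler1z -gtz0_ge1 exprn_even_gt0.
Qed.

(** In the Leibniz formula each of the n! products takes one entry from every row. *)
Lemma normr_det_le (R : realDomainType) (n : nat) (A : 'M[R]_n) (b : 'I_n -> R) :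
  (forall i k, `|A i k| <= b i) -> `|\det A| <= n`!%:R * \prod_i b i.
Proof.
move=> Ab; apply: le_trans (ler_norm_sum _ _ _) _.
apply: (@le_trans _ _ (\sum_(s : 'S_n) \prod_i b i)).
  apply: ler_sum => s _; rewrite normrM normrX normrN1 expr1n mul1r normr_prod.
  by apply: ler_prod => i _; rewrite normr_ge0 Ab.
by rewrite sumr_const card_Sn mulr_natl.
Qed.

Lemma squarefree_sqr_neq (D : int) (r : rat) :
  1 < D -> squarefree D -> r ^+ 2 != D%:~R.
Proof.
move=> D1 Dsf; apply/eqP => rD.
have numD : numq r ^+ 2 = D * denq r ^+ 2.
  apply/eqP; rewrite -(eqr_int rat) rmorphXn [eqbRHS]rmorphM rmorphXn /= -rD -exprMn.
  by rewrite numqE.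
(* The denominator is coprime to [numq r ^+ 2], a multiple of it, hence to itself. *)
have den1 : `|denq r|%N = 1%N.
  have := coprimeXl 2 (coprime_num_den r); rewrite -abszX numD abszM abszX.
  rewrite coprimeMl coprime_pexpl // [X in _ && X]/coprime gcdnn.
  by move=> /andP [_ /eqP].
have {}numD : numq r ^+ 2 = D.
  by rewrite numD -[denq r]gez0_abs ?denq_ge0 // den1 mulr1.
have num1 := Dsf (numq r); rewrite numD dvdzz in num1.
by move: D1; rewrite -numD -(real_normK (num_real _)) -abszE num1.
Qed.

Lemma sumr_sqr_ge (R : realDomainType) (T : eqType) (s : seq T) (f : T -> R)
    (y : T) :
  y \in s -> f y ^+ 2 <= \sum_(z <- s) f z ^+ 2.
Proof.
move=> ys; rewrite (big_rem y ys) /= lerDl.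
by apply: sumr_ge0 => z _; apply: sqr_ge0.
Qed.

Lemma powR_quarter_bound (R : realType) (c eps : R) (m Delta : int) :
  0 < c < 1 -> 0 < eps -> 0 < m ->
  m%:~R <= c * (Delta%:~R `^ (4^-1 - eps)) ->
  0 < Delta /\ m%:~R ^+ 4 <= c ^+ 4 * Delta%:~R.
Proof.
move=> /andP [c0 c1] eps0 m0 mle.
have m1 : (1 : R) <= m%:~R by rewrite ler1z -gtz0_ge1.
(* By convention [powR] is 1 at a negative base and 0 or 1 at base 0, so a nonpositive Delta would
   give m <= c < 1. *)
have [Delta_le0|Delta_gt0] := leP Delta 0.
  have : (Delta%:~R : R) `^ (4^-1 - eps) <= 1.
    move: Delta_le0; rewrite le_eqVlt => /predU1P [->|neg].
      by rewrite /powR eqxx; case: eqP; rewrite ?ler01 ?lexx.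
    by rewrite lt0_powR1 ?ltrz0.
  move=> /(ler_wpM2l (ltW c0)); rewrite mulr1 => /(le_trans mle) /(le_trans m1).
  by rewrite leNgt c1.
have Delta1 : (1 : R) <= Delta%:~R by rewrite ler1z -gtz0_ge1.
split=> //.
have DeltaE : (Delta%:~R `^ 4^-1) ^+ 4 = Delta%:~R :> R.
  rewrite -powR_mulrn ?powR_ge0 // -powRrM mulVf ?pnatr_eq0 // powRr1 //.
  exact: le_trans ler01 Delta1.
rewrite -[X in _ * X]DeltaE -exprMn lerXn2r ?nnegrE //.
- exact: le_trans ler01 m1.
- by rewrite mulr_ge0 ?powR_ge0 // ltW.
(* As Delta >= 1, lowering the exponent 1/4 by [eps] does not increase the power. *)
apply: le_trans mle _; rewrite ler_pM2l // ler_powR //.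
by rewrite gerBl ltW.
Qed.

(** With C = 1/(576 d), m^4 <= C^4 (24 d r^2)^2 = (C r^2 / 24)^2, since C d = 1/24^2. Hence (24 m)^2
    <= 24 C r^2 <= r^2. *)
Lemma descent_threshold (R : realFieldType) (d r m Delta : R) :
  1 <= d -> 0 <= r -> 0 <= m ->
  m ^+ 4 <= (576 * d)^-1 ^+ 4 * Delta -> Delta <= (24 * d * r ^+ 2) ^+ 2 ->
  24 * m <= r.
Proof.
move=> d1 r0 m0 m4le Delta_le; have d0 : 0 < d by lra.
have C0 : 0 < (576 * d)^-1 by rewrite invr_gt0; lra.
have Cd : (576 * d)^-1 * d = 576^-1 by rewrite invfM divfK ?gt_eqF.
(* The inverse becomes a variable known only by C > 0 and C d = 1/576, which leaves polynomial
   goals. *)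
move: (_^-1) C0 Cd m4le => C C0 Cd m4le.
have r2 : 0 <= r ^+ 2 := sqr_ge0 r.
have m2 : m ^+ 2 <= C / 24 * r ^+ 2.
  rewrite -(@ler_pXn2r _ 2) ?nnegrE ?sqr_ge0 //; last by rewrite mulr_ge0 //; lra.
  rewrite -exprM; apply: le_trans m4le _.
  have -> : (C / 24 * r ^+ 2) ^+ 2 = C ^+ 4 * (24 * d * r ^+ 2) ^+ 2.
    have -> : C / 24 = C * 24 * 576^-1 by field.
    by rewrite -Cd; ring.
  by rewrite ler_wpM2l // exprn_ge0 // ltW.
have C_le : C <= 576^-1 by nra.
have m24 : 0 <= 24 * m by lra.
by rewrite -ler_sqr ?nnegrE //; nra.
Qed.

(** * The quadratic subfield F and the descent on integers outside it *)

Section QuadraticSubfield.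
Variables (K : fieldExtType rat) (D : int) (s : K).
Hypotheses (D_gt1 : 1 < D) (D_sqfree : squarefree D) (s2 : s ^+ 2 = D%:~R).
Local Notation F := <<1; s>>%AS.

Lemma quadratic_integer : ringOfIntegers s.
Proof.
exists ('X^2 - D%:P); first by rewrite monicXnsubC.
rewrite rmorphB /= map_polyXn map_polyC /= /root !hornerE s2 subrr //.
Qed.

Lemma dim_quadratic_le2 : (\dim F <= 2)%N.
Proof.
rewrite dim_Fadjoin dimv1 muln1 -ltnS -size_minPoly.
rewrite -[X in (_ <= X)%N](size_XnsubC (D%:~R : K) (isT : 0 < 2)%N).
apply: dvdp_leq; first by rewrite -size_poly_gt0 size_XnsubC.
apply: minPoly_dvdp; last by rewrite /root !hornerE s2 subrr.
by rewrite rpredB ?rpredX ?polyOverX ?polyOverC ?rpred_int.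
Qed.

Lemma quadratic_free (a b : rat) : a *: 1 + b *: s = 0 -> a = 0 /\ b = 0.
Proof.
move=> ab0.
have b0 : b = 0.
  apply/eqP/contraT => b_neq0.
  have sE : s = (- a / b)%:A.
    apply: (scalerI b_neq0); rewrite scalerA mulrC divfK // scaleNr.
    by apply/eqP; rewrite -addr_eq0 addrC ab0.
  case/negP: (squarefree_sqr_neq D (- a / b) D_gt1 D_sqfree).
  rewrite -(inj_eq (fmorph_inj (GRing.in_alg K))) rmorphXn rmorph_int /=.
  by rewrite -sE s2.
split=> //; move/eqP: ab0; rewrite b0 scale0r addr0 scaler_eq0 oner_eq0 orbF.
by move/eqP.
Qed.

Definition towerFamily (y : K) (i : 'I_4) : K := [:: 1; s; y; s * y]`_i.

Lemma towerFamily_integer (y : K) (i : 'I_4) :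
  ringOfIntegers y -> ringOfIntegers (towerFamily y i).
Proof.
move=> y_int; case: i => [[|[|[|[|i]]]] hi] //; rewrite /towerFamily /=.
- exact: integral1.
- exact: quadratic_integer.
- exact: integral_mul quadratic_integer y_int.
Qed.

(** A relation reads u + u' y = 0 with u, u' in F. If u' were nonzero, y = -u/u' would lie in F; so
    both vanish, and 1, s are independent over the rationals. *)
Lemma towerFamily_free (y : K) (v : 'I_4 -> rat) :
  y \notin F -> \sum_i v i *: towerFamily y i = 0 -> forall i, v i = 0.
Proof.
move=> yF; rewrite /towerFamily !big_ord_recl big_ord0 /= addr0.
set v0 := v _; set v1 := v _; set v2 := v _; set v3 := v _ => v_comb.
have FP a b : a *: 1 + b *: s \in F.
  by rewrite rpredD ?rpredZ ?rpred1 ?memv_adjoin.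
have {}v_comb : (v0 *: 1 + v1 *: s) + (v2 *: 1 + v3 *: s) * y = 0.
  by rewrite mulrDl -!scalerAl mul1r -addrA.
have [v20 v30] : v2 = 0 /\ v3 = 0.
  apply: quadratic_free; apply/eqP/contraT => u_neq0; case/negP: yF.
  have -> : y = - (v0 *: 1 + v1 *: s) / (v2 *: 1 + v3 *: s).
    apply: (mulfI u_neq0); rewrite mulrCA mulfV // mulr1; apply/eqP.
    by rewrite -addr_eq0 addrC v_comb.
  by rewrite rpred_div ?rpredN ?FP.
have [v00 v10] : v0 = 0 /\ v1 = 0.
  by apply: quadratic_free; move: v_comb; rewrite v20 v30 !scale0r addr0 mul0r addr0.
case=> [[|[|[|[|i]]]] hi] //; [rewrite -[RHS]v00|rewrite -[RHS]v10|
  rewrite -[RHS]v20|rewrite -[RHS]v30]; congr v; exact: val_inj.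
Qed.

Variables (R : realType) (sigma : 'I_4 -> {rmorphism K -> R}).

(** All conjugates of s have absolute value q = sqrt D, so the rows are bounded by 1, q, r, q r,
    with product D r^2; 24 is 4!. *)
Lemma towerFamily_det_le (y : K) (r : R) :
  (forall k, `|sigma k y| <= r) ->
  \det (\matrix_(i, k) sigma k (towerFamily y i)) ^+ 2 <=
    (24 * D%:~R * r ^+ 2) ^+ 2.
Proof.
move=> yr; set q := Num.sqrt (D%:~R : R).
have D0 : (0 : R) <= D%:~R by rewrite ler0z ltW // (lt_trans _ D_gt1).
have sq k : `|sigma k s| = q.
  by rewrite -sqrtr_sqr -rmorphXn s2 rmorph_int.
rewrite -[X in X <= _]real_normK ?num_real //.
have r0 : 0 <= r := le_trans (normr_ge0 _) (yr ord0).
rewrite lerXn2r ?nnegrE ?normr_ge0 ?mulr_ge0 ?sqr_ge0 ?ler0n //.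
have := @normr_det_le _ _ (\matrix_(i, k) sigma k (towerFamily y i))
  (fun i : 'I_4 => [:: 1; q; r; q * r]`_i).
rewrite !big_ord_recl big_ord0 /= mul1r mulr1.
have -> : q * (r * (q * r)) = D%:~R * r ^+ 2.
  by rewrite -[D%:~R](sqr_sqrtr D0) -/q; ring.
rewrite mulrA; apply => i k; rewrite mxE /towerFamily.
case: i => [[|[|[|[|i]]]] hi] //=.
- by rewrite rmorph1 normr1.
- by rewrite sq.
- by rewrite rmorphM normrM sq ler_wpM2l ?sqrtr_ge0.
Qed.

(** The matrix factors through a basis of F, so its rank is at most 2. This will show that an
    integral basis cannot lie in F. *)
Lemma det_subfield_eq0 (w : 'I_4 -> K) :
  (forall i, w i \in F) -> \det (\matrix_(i, k) sigma k (w i)) = 0.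
Proof.
move=> wF; apply/eqP/contraT => det_neq0.
have : \rank (\matrix_(i, k) sigma k (w i)) = 4%N.
  by apply: mxrank_unit; rewrite unitmxE unitfE.
pose A : 'M[R]_(4, \dim F) := \matrix_(i, j) ratr (coord (vbasis F) j (w i)).
pose B : 'M[R]_(\dim F, 4) := \matrix_(j, k) sigma k (vbasis F)`_j.
have -> : \matrix_(i, k) sigma k (w i) = A *m B.
  apply/matrixP => i k; rewrite !mxE {1}(coord_vbasis (wF i)) rmorph_sum.
  by apply: eq_bigr => j _; rewrite !mxE rmorphZ_num.
move=> rank4; have := leq_trans (mxrankM_maxl A B) (rank_leq_col A).
by rewrite rank4 => /leq_trans /(_ dim_quadratic_le2).
Qed.

Variable m : int.
Hypothesis m_gt0 : 0 < m.
Hypothesis all_sigma : forall rho : {rmorphism K -> R}, exists i, rho =1 sigma i.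
Hypothesis all_sums_of_squares :
  forall a : K, multTotallyPositive R m a -> sumOfIntegerSquares a.

Lemma descent_step (y : K) (r : R) :
  ringOfIntegers y -> y \notin F -> 24 * m%:~R <= r ->
  (forall k, `|sigma k y| <= r) ->
  exists z : K, [/\ ringOfIntegers z, z \notin F &
    forall k, `|sigma k z| <= r / 2].
Proof.
move=> y_int yF mr yr.
have m1 : (1 : R) <= m%:~R by rewrite ler1z -gtz0_ge1.
have r0 : 0 <= r := le_trans (normr_ge0 _) (yr ord0).
pose N := (Num.truncn r).+1.
have /andP [Nr rN] : (N%:R <= r + 1) && (r < N%:R).
  have /andP [] := truncn_itv r0; rewrite -natr1 => ? ->; by rewrite andbT lerD2r.
have [l l_int lE] : sumOfIntegerSquares (m%:~R * (y + N%:R)).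
  apply: all_sums_of_squares; exists (y + N%:R) => //; split=> [|rho].
    exact: integral_add y_int (integral_nat _ _).
  have [k ->] := all_sigma rho.
  rewrite rmorphD rmorph_nat -ltrBlDr sub0r.
  by have := le_lt_trans (yr k) rN; rewrite ltr_norml => /andP [].
(* If all terms were in F, solving for y would put y in F. *)
have [/allP lF|/allPn [z zl zF]] := boolP (all [in F] l).
  case/negP: yF.
  have -> : y = m%:~R^-1 * \sum_(z <- l) z ^+ 2 - N%:R.
    rewrite -lE mulKf ?addrK //.
    by rewrite -(rmorph_int (GRing.in_alg K)) fmorph_eq0 intr_eq0 gt_eqF.
  rewrite rpredB ?rpred_nat // rpredM ?rpredV ?rpred_int //.
  by rewrite big_seq rpred_sum // => z /lF zF; rewrite rpredX.
exists z; split=> [||k]; [exact: l_int|by []|].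
rewrite -ler_sqr ?nnegrE ?normr_ge0 ?divr_ge0 ?ler0n // real_normK ?num_real //.
apply: (@le_trans _ _ (m%:~R * (sigma k y + N%:R))).
  have -> : m%:~R * (sigma k y + N%:R) = sigma k (m%:~R * (y + N%:R)).
    by rewrite rmorphM rmorphD rmorph_nat rmorph_int.
  rewrite lE rmorph_sum /=.
  under eq_bigr => x _ do rewrite rmorphXn /=.
  exact: sumr_sqr_ge.
(* As r >= 24 m >= 24, m (2r + 1) <= (r / 24) (3r) = r^2 / 8, below (r / 2)^2. *)
have yk : sigma k y <= r := le_trans (ler_norm _) (yr k).
nra.
Qed.

Lemma descent :
  (forall y (r : R), ringOfIntegers y -> y \notin F ->
     (forall k, `|sigma k y| <= r) -> 24 * m%:~R <= r) ->
  forall y, ringOfIntegers y -> y \in F.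
Proof.
move=> low y y_int; apply: contraT => yF.
have m1 : (1 : R) <= m%:~R by rewrite ler1z -gtz0_ge1.
(* Bounds that are powers of 2 turn halving into induction on the exponent; at j = 0 the bound 1
   contradicts 24 m <= 1. *)
have small j (z : K) : ringOfIntegers z -> z \notin F ->
    (forall k, `|sigma k z| <= 2 ^+ j) -> False.
  elim: j z => [|j IHj] z z_int zF zj.
    have := low _ _ z_int zF zj; rewrite expr0; lra.
  have [x [x_int xF xj]] := descent_step _ _ z_int zF (low _ _ z_int zF zj) zj.
  apply: (IHj x x_int xF) => k; apply: le_trans (xj k) _.
  by rewrite exprS mulrC mulKf ?pnatr_eq0.
(* The sum serves as a common bound for all conjugates, and some power of 2 exceeds it. *)
pose b := \sum_k `|sigma k y|.
have [] // := small (Num.truncn b).+1 y => k.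
have b0 : 0 <= b by apply: sumr_ge0.
apply: (@le_trans _ _ b).
  by rewrite /b (bigD1 k) //= lerDl sumr_ge0.
have /andP [_ /ltW /le_trans] := truncn_itv b0; apply.
by rewrite -natrX ler_nat ltnW // ltn_expl.
Qed.

End QuadraticSubfield.

(** * Choice of the constant and conclusion *)

Theorem corollary5p2 (R : realType) (D : int) (eps : R) :
  1 < D -> squarefree D -> 0 < eps ->
  exists c : R, 0 < c /\
    forall (K : fieldExtType rat) (Delta : int),
      \dim {:K} = 4%N ->
      totallyReal K R ->
      (exists s : K, s ^+ 2 = D%:~R) ->
      isDiscriminant K Delta ->
      forall m : int, 0 < m ->
        m%:~R <= c * (Delta%:~R `^ (4^-1 - eps)) ->
        exists a : K, multTotallyPositive R m a /\ ~ sumOfIntegerSquares a.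
Proof.
move=> D1 Dsf eps0.
have DR1 : (1 : R) < D%:~R by rewrite ltr1z.
have D0 : (0 : R) < D%:~R by lra.
have c0 : 0 < (576 * D%:~R)^-1 :> R by rewrite invr_gt0; lra.
have c1 : (576 * D%:~R)^-1 < 1 :> R by rewrite invf_lt1; lra.
(* Any positive c < 1 with c <= 1/(24 sqrt(24 D)) would suit the descent; this smaller value avoids
   the square root. *)
exists (576 * D%:~R)^-1; split=> // K Delta dimK Kreal [s s2] disc m m0 mle.
have [] := powR_quarter_bound R _ eps m Delta _ eps0 m0 mle; first by rewrite c0.
move=> Delta0 m4le.
have [sigma [w [all_sigma w_int w_span DeltaE]]] :=
  totallyReal_discriminant K R 4 Delta dimK Kreal disc.
apply: contrapT => no_a.
have all_sums (a : K) : multTotallyPositive R m a -> sumOfIntegerSquares a.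
  by move=> ma; apply: contrapT => a_sum; apply: no_a; exists a.
have low (y : K) (r : R) : ringOfIntegers y -> y \notin <<1; s>>%AS ->
    (forall k, `|sigma k y| <= r) -> 24 * m%:~R <= r.
  move=> y_int yF yr.
  have r0 : 0 <= r := le_trans (normr_ge0 _) (yr ord0).
  have : Delta%:~R <= (24 * D%:~R * r ^+ 2) ^+ 2.
    rewrite DeltaE; apply: le_trans (towerFamily_det_le K D s D1 s2 R sigma y r yr).
    apply: integer_comb_det => [i|v].
      by apply: w_span; apply: (towerFamily_integer K D s s2).
    exact: (towerFamily_free K D s D1 Dsf s2 y v yF).
  by move=> Delta_le; apply: (descent_threshold R D%:~R r m%:~R Delta%:~R);
    rewrite ?ler0z ?(ltW m0) ?(ltW DR1).
(* The descent places every integer, hence the integral basis, in F; this makes Delta zero, although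
   it is positive. *)
have : \det (\matrix_(i, k) sigma k (w i)) = 0.
  apply: (det_subfield_eq0 K D s) => // i.
  exact: (descent K s R sigma m m0 all_sigma all_sums low).
move=> det0; move: DeltaE; rewrite det0 expr0n /= => /eqP.
by rewrite intr_eq0 gt_eqF.
Qed.
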